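(* Let $(G,u,v,\alpha,\beta)$ be a Guvab with $\beta<1$, with associated Wasserstein distances $W_k$. Then the sequence $\{W_k\}_{k\ge0}$ is eventually constant if and only if one of the following holds: (1) $\alpha=\beta=0$, $G$ is bipartite, and $d(u,v)$ is odd; (2) $\alpha=0$, $\beta=\frac12$, and $G$ is bipartite; (3) $\alpha=\beta=0$ and $N(u)=N(v)$; (4) $\alpha=\beta=\frac{1}{\deg u+1}$, $\{u,v\}\in E(G)$, and in the graph obtained by removing the edge $\{u,v\}$ from $G$, the vertices $u$ and $v$ have the same neighbor set; (5) $\alpha=\beta$ and $u=v$.
   Context: A Guvab is a tuple $(G,u,v,\alpha,\beta)$ where $G$ is a finite, connected, simple graph, $u,v\in V(G)$, and $\alpha,\beta\in[0,1]$ with $\alpha\le\beta$. A random walk on $G$ with starting vertex $w$ and laziness $\gamma$ is the Markov chain $R_0=w$ and, for $i\ge1$, $R_i=R_{i-1}$ with probability $\gamma$ and $R_i=t$ with probability $\frac{1-\gamma}{\deg(R_{i-1})}$ for each neighbor $t$ of $R_{i-1}$. Let $\mu_k$ be the distribution of the $k$-th step of the walk from $u$ with laziness $\alpha$ and $\nu_k$ that of the walk from $v$ with laziness $\beta$. $W_k=W(\mu_k,\nu_k)$ is the Wasserstein ($L^1$ optimal transport) distance with respect to the graph distance $d$: the minimum over transportation plans (nonnegative $T$ on $V(G)\times V(G)$ with marginals $\mu_k,\nu_k$) of $\sum d(w_1,w_2)T(w_1,w_2)$. $N(w)$ denotes the neighbor set of $w$. A sequence $\{S_i\}$ is eventually constant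 if there is $N$ with $S_k=S_N$ for all $k\ge N$. *)

(* Defs.v *)
From mathcomp Require Import all_boot all_order all_algebra.
From mathcomp Require Import classical_sets reals.
Set Implicit Arguments. Unset Strict Implicit. Unset Printing Implicit Defensive.
Import Order.TTheory GRing.Theory Num.Theory.
Local Open Scope ring_scope.
Local Open Scope classical_set_scope.

Section Graph.
Variable T : finType.
Variable e : rel T.

Definition simple_graph : Prop := symmetric e /\ irreflexive e.
Definition connected_graph : Prop := forall x y : T, connect e x y.

Definition nbhd (w : T) : {set T} := [set y | e w y].
Definition deg (w : T) : nat := #|nbhd w|.

Definition bipartite : Prop :=
  exists f : T -> bool, forall x y, e x y -> f x != f y.

Fixpoint ball (n : nat) (x : T) : {set T} :=
  if n is n'.+1 then ball n' x :|: \bigcup_(y in ball n' x) nbhd y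
  else [set x].

(* graph distance: least n with y in ball n x (for connected graphs
   this is < #|T|, so the search range is sufficient) *)
Definition gdist (x y : T) : nat := find (fun n => y \in ball n x) (iota 0 #|T|).

Variable R : realType.

Fixpoint walk (g : R) (w : T) (k : nat) (t : T) : R :=
  if k is k'.+1 then
    g * walk g w k' t
    + \sum_(s : T | e s t) (1 - g) / (deg s)%:R * walk g w k' s
  else (t == w)%:R.

Definition transport_plan (mu nu : T -> R) (P : T -> T -> R) : Prop :=
  (forall x y, 0 <= P x y) /\
  (forall x, \sum_(y : T) P x y = mu x) /\
  (forall y, \sum_(x : T) P x y = nu y).

Definition transport_cost (P : T -> T -> R) : R :=
  \sum_(x : T) \sum_(y : T) (gdist x y)%:R * P x y.

(* L^1 Wasserstein distance: the minimum (here written as the infimum,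
   which is attained) of the transport cost over transportation plans *)
Definition wasserstein (mu nu : T -> R) : R :=
  inf [set c | exists P, transport_plan mu nu P /\ c = transport_cost P].

Definition W_seq (u v : T) (a b : R) (k : nat) : R :=
  wasserstein (walk a u k) (walk b v k).

End Graph.

Definition eventually_constant (R : Type) (S : nat -> R) : Prop :=
  exists N, forall k, (N <= k)%N -> S k = S N.

(* Main.v *)
(* If the laws mu_k and nu_k merge (which happens unless a = 0 and G is
   bipartite, or when a = b = 0 and u, v lie on the same side), then W_k -> 0, so
   W_k is eventually constant iff mu_k = nu_k from some time on. The one-step
   operator is self-adjoint for the weight 1 / deg, so its powers have no larger
   kernel than itself, and coincidence at a late time forces coincidence at
   time 1; this gives u = v or one of the two neighbourhood conditions.
   In the remaining case a = 0 and G has sides X, Y with mu_k carried by one of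
   them, say X_k. Moving nu_k(Y_k) out of X_k along edges is eventually feasible,
   because the required flow is a small perturbation of a positive one, and it is
   optimal, the indicator of X_k being 1-Lipschitz. Hence W_k = nu_k(Y_k) =
   (1 -+ (1 - 2 b)^k) / 2 for large k, which is eventually constant iff b = 0 or
   b = 1 / 2. *)

Require Import Defs.
From mathcomp Require Import all_boot all_order all_algebra.
From mathcomp Require Import classical_sets reals boolp.
From mathcomp Require Import ring lra.
Import Order.TTheory GRing.Theory Num.Theory.
Local Open Scope ring_scope.

(** * The lazy walk as a reversible Markov operator *)

Section LazyWalk.
Variables (R : realType) (T : finType) (e : rel T).
Hypothesis sg : simple_graph e.
Hypothesis cg : connected_graph e.
Hypothesis T2 : (1 < #|T|)%N.

Let eC : symmetric e := sg.1.

Definition coloring (f : T -> bool) := forall x y, e x y -> f x != f y.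

Lemma exists_neighbor w : exists t, e w t.
Proof.
have [t tw] : exists t, t != w.
  apply/existsP; rewrite -negb_forall; apply/negP => /forallP H.
  move: T2; rewrite ltnNge => /negP; apply.
  rewrite -(card1 w); apply: subset_leq_card; apply/fintype.subsetP => x _.
  by rewrite inE; apply: H.
have /connectP [[|y p] /=] := cg w t; first by move=> _ tE; rewrite tE eqxx in tw.
by case/andP=> ewy _ _; exists y.
Qed.

Lemma deg_gt0 w : (0 : R) < (deg e w)%:R.
Proof.
rewrite ltr0n; have [t ewt] := exists_neighbor w.
by apply/card_gt0P; exists t; rewrite inE.
Qed.

Lemma deg_neq0 w : (deg e w)%:R != 0 :> R.
Proof. by rewrite gt_eqF // deg_gt0. Qed.

Lemma degE w : (deg e w)%:R = \sum_t (e w t)%:R :> R.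
Proof.
rewrite -natr_sum; congr _%:R; rewrite /deg -sum1_card.
rewrite big_mkcond /=; apply: eq_bigr => t _.
by rewrite inE; case: (e w t).
Qed.

Definition kernel (g : R) (s t : T) : R :=
  g * (s == t)%:R + (1 - g) / (deg e s)%:R * (e s t)%:R.

Definition step (g : R) (x : T -> R) (t : T) : R := \sum_s x s * kernel g s t.

Definition evol (g : R) (k : nat) (x : T -> R) : T -> R := iter k (step g) x.

Definition point_mass (w : T) (t : T) : R := (t == w)%:R.

Lemma sum_point_mass (f : T -> R) w : \sum_s point_mass w s * f s = f w.
Proof.
rewrite (bigD1 w) //= /point_mass eqxx mul1r big1 ?addr0 // => s /negPf ->.
by rewrite mul0r.
Qed.

Lemma stepE g x t :
  step g x t = g * x t + \sum_(s | e s t) (1 - g) / (deg e s)%:R * x s.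
Proof.
rewrite /step /kernel; under eq_bigr do rewrite mulrDr.
rewrite big_split /=; congr (_ + _).
  rewrite (bigD1 t) //= eqxx big1 ?addr0; first by rewrite mulr1 mulrC.
  by move=> s /negPf ->; rewrite !mulr0.
rewrite [RHS]big_mkcond /=; apply: eq_bigr => s _.
by case: (e s t); rewrite ?mulr1 ?mulr0 // mulrC.
Qed.

Lemma walkE g w k : walk e g w k = evol g k (point_mass w).
Proof.
elim: k => [|k IH] //; apply/funext => t.
by rewrite /evol iterS stepE -/(evol g k _) -IH.
Qed.

Lemma evolE g k x t : evol g k x t = \sum_s x s * walk e g s k t.
Proof.
elim: k t => [|k IH] t.
  rewrite /= (bigD1 t) //= eqxx mulr1 big1 ?addr0 // => s.
  by rewrite eq_sym => /negPf ->; rewrite mulr0.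
rewrite /evol iterS {1}/step -/(evol g k x).
under eq_bigr do rewrite IH mulr_suml.
rewrite exchange_big; apply: eq_bigr => s _.
rewrite (walkE g s k.+1) /evol iterS /step mulr_sumr -/(evol g k _) -walkE.
by apply: eq_bigr => z _; rewrite mulrA.
Qed.

Lemma evolB g k x y t :
  evol g k (fun s => x s - y s) t = evol g k x t - evol g k y t.
Proof.
rewrite !evolE -sumrB; apply: eq_bigr => s _; ring.
Qed.

Lemma evolZ g k c x t : evol g k (fun s => c * x s) t = c * evol g k x t.
Proof. by rewrite !evolE mulr_sumr; apply: eq_bigr => s _; rewrite mulrA. Qed.

Lemma evolD g j k x : evol g (j + k) x = evol g j (evol g k x).
Proof. by rewrite /evol iterD. Qed.

Lemma walk_add (g : R) s j k t :
  walk e g s (j + k) t = \sum_z walk e g s k z * walk e g z j t.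
Proof. by rewrite walkE evolD evolE -walkE. Qed.

Lemma sum_kernel g s : \sum_t kernel g s t = 1.
Proof.
rewrite /kernel big_split /= -!mulr_sumr -degE.
rewrite (bigD1 s) //= eqxx big1; last by move=> t; rewrite eq_sym => /negPf ->.
by rewrite addr0 mulr1; field; exact: deg_neq0.
Qed.

(** Detailed balance for the weight [deg]: off the diagonal both sides are [1 - g] times the
    indicator of the edge. *)
Lemma kernel_rev g s t :
  (deg e s)%:R * kernel g s t = (deg e t)%:R * kernel g t s.
Proof.
rewrite /kernel (eC t s) (eq_sym t s).
case: eqP => [->|_] //; rewrite !mulr0 !add0r; field.
by rewrite !deg_neq0.
Qed.

Lemma sum_evol g k x : \sum_t evol g k x t = \sum_t x t.
Proof.
elim: k => [|k IH] //; rewrite /evol iterS /step exchange_big /= -IH.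
by apply: eq_bigr => s _; rewrite -mulr_sumr sum_kernel mulr1.
Qed.

Lemma sum_walk (g : R) w k : \sum_t walk e g w k t = 1.
Proof.
rewrite walkE sum_evol -[RHS](sum_point_mass (fun=> 1) w).
by apply: eq_bigr => s _; rewrite mulr1.
Qed.

(** * Positivity of transition probabilities and parity of times *)

Section Laziness.
Variable g : R.
Hypotheses (g0 : 0 <= g) (g1 : g < 1).

Lemma kernel_ge0 s t : 0 <= kernel g s t.
Proof.
by rewrite addr_ge0 // !mulr_ge0 ?invr_ge0 ?ler0n // subr_ge0 ltW.
Qed.

Lemma walk_ge0 w k t : 0 <= walk e g w k t.
Proof.
rewrite walkE; elim: k t => [|k IH] t; first by rewrite ler0n.
by rewrite /evol iterS; apply: sumr_ge0 => s _; rewrite mulr_ge0 ?kernel_ge0 // IH.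
Qed.

Lemma kernel_gt0 s t : e s t -> 0 < kernel g s t.
Proof.
move=> est; rewrite /kernel est mulr1 ltr_wpDl ?mulr_ge0 ?ler0n //.
by rewrite divr_gt0 ?deg_gt0 // subr_gt0.
Qed.

Lemma walk_trans s z t j k :
  0 < walk e g s k z -> 0 < walk e g z j t -> 0 < walk e g s (k + j) t.
Proof.
move=> h1 h2; rewrite addnC walk_add (bigD1 z) //= ltr_pwDl ?mulr_gt0 //.
by apply: sumr_ge0 => y _; rewrite mulr_ge0 ?walk_ge0.
Qed.

Lemma walk1E s t : walk e g s 1 t = kernel g s t.
Proof. by rewrite walkE /= /step sum_point_mass. Qed.

Lemma walk_rev k s t :
  (deg e s)%:R * walk e g s k t = (deg e t)%:R * walk e g t k s.
Proof.
elim: k s t => [|k IH] s t.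
  by rewrite /= (eq_sym s t); case: eqP => [->|_] //; rewrite !mulr0.
rewrite -addn1 walk_add addnC walk_add !mulr_sumr; apply: eq_bigr => z _.
rewrite !walk1E mulrA kernel_rev -!mulrA mulrCA [LHS]mulrA.
by rewrite mulrAC mulrC mulrA IH; ring.
Qed.

Lemma walk_sym k s t : 0 < walk e g s k t -> 0 < walk e g t k s.
Proof.
move=> h; rewrite -(pmulr_rgt0 _ (deg_gt0 t)) -walk_rev.
by rewrite pmulr_rgt0 ?deg_gt0.
Qed.

Lemma walk_edge s t : e s t -> 0 < walk e g s 1 t.
Proof. by rewrite walk1E => /kernel_gt0. Qed.

Lemma walk_reach s t : exists k, 0 < walk e g s k t.
Proof.
have /connectP [p ep ->] := cg s t.
elim: p s ep => [|y p IH] s /=; first by exists 0%N; rewrite /= eqxx ltr01.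
case/andP=> esy /IH [k hk]; exists (1 + k)%N.
exact: walk_trans (walk_edge _ _ esy) hk.
Qed.

Lemma walk_return s : 0 < walk e g s 2 s.
Proof.
have [t est] := exists_neighbor s.
by apply: (@walk_trans s t s 1 1); apply: walk_edge; rewrite // eC.
Qed.

(** Two spare steps can go to a neighbour and back, so positivity persists along even times even
    without laziness. This is why times are doubled below. *)
Lemma walk_mono s t i j :
  (i <= j)%N -> 0 < walk e g s i.*2 t -> 0 < walk e g s j.*2 t.
Proof.
move=> /subnK <-; elim: (j - i)%N => [|n IH] // h.
rewrite addSn doubleS; exact: walk_trans (walk_return s) (IH h).
Qed.

Lemma uniform_time (sim : rel T) :
  (forall s t, sim s t -> exists j, 0 < walk e g s j.*2 t) ->
  exists J, forall s t, sim s t -> 0 < walk e g s J.*2 t.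
Proof.
move=> h.
have /choice [J HJ] : forall p : T * T, exists j,
    sim p.1 p.2 -> 0 < walk e g p.1 j.*2 p.2.
  move=> [s t] /=; case: (boolP (sim s t)) => [/h [j hj]|_]; last by exists 0%N.
  by exists j.
exists (\max_p J p) => s t st.
by apply: (walk_mono s t (J (s, t))); [exact: leq_bigmax | exact: (HJ (s, t) st)].
Qed.

(** If [t] is never reached from [s] at an even time, every time of reaching it is odd. A lazy step
    at [s] would break this parity; without laziness the parity yields a 2-colouring. *)
Lemma aperiodic_time :
  0 < g \/ ~ bipartite e -> exists J, forall s t, 0 < walk e g s J.*2 t.
Proof.
move=> h; suff /uniform_time [J HJ] :
    forall s t, true -> exists j, 0 < walk e g s j.*2 t.
  by exists J => s t; apply: HJ.
move=> s t _; apply: contrapT => nst.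
have key x k : 0 < walk e g s k x -> ~~ odd k -> exists j, 0 < walk e g s j.*2 x.
  move=> hk /negPf ok; exists k./2.
  by move: (odd_double_half k); rewrite ok add0n => ->.
have odd_st k : 0 < walk e g s k t -> odd k.
  by move=> hk; apply: contrapT => /negP ok; apply: nst; apply: key hk ok.
have [k0 hk0] := walk_reach s t.
case: h => [gpos|]; last apply.
  have : 0 < walk e g s (1 + k0) t.
    apply: walk_trans hk0; rewrite walk1E /kernel eqxx mulr1 ltr_pwDl //.
    by rewrite !mulr_ge0 ?invr_ge0 ?ler0n // subr_ge0 ltW.
  by move=> /odd_st; rewrite oddD (odd_st _ hk0).
(* Colour by being reached from [s] at an even time. An edge inside the reached class closes an odd
   loop at [s], which makes [t] reachable at an even time; an edge outside it makes [y] reachable at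
   an even time. *)
exists (fun w => `[< exists j, 0 < walk e g s j.*2 w >]) => x y exy.
apply/eqP => Exy; case: (asboolP (exists j, 0 < walk e g s j.*2 x)) Exy.
  move=> [i hi] /esym /asboolP [j hj].
  have h1 := walk_trans _ _ _ _ _ (walk_trans _ _ _ _ _ hi (walk_edge _ _ exy))
     (walk_sym _ _ _ hj).
  have /odd_st := walk_trans _ _ _ _ _ h1 hk0.
  by rewrite !oddD !odd_double (odd_st _ hk0).
move=> nx /esym /asboolP; apply.
have [k hk] := walk_reach s x.
have hy := walk_trans _ _ _ _ _ hk (walk_edge _ _ exy).
apply: (key _ _ hy); rewrite oddD addbT negbK.
by apply: contrapT => /negP ok; apply: nx; apply: key hk ok.
Qed.

End Laziness.

Lemma walk_parity (f : T -> bool) k s t : coloring f ->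
  0 < walk e (0 : R) s k t -> f t = f s (+) odd k.
Proof.
move=> bf; elim: k t => [|k IH] t /=.
  by case: eqP => [->|]; rewrite ?ltxx ?addbF.
rewrite mul0r add0r => h.
have [z [ezt]] : exists z, e z t /\ (1 - 0 : R) / (deg e z)%:R * walk e 0 s k z != 0.
  apply: contrapT => H; move: h; rewrite big1 ?ltxx // => z ezt.
  by apply/eqP/negPn/negP => wn0; apply: H; exists z.
rewrite mulf_eq0 negb_or => /andP [_ wn0].
have := IH z; rewrite lt0r wn0 walk_ge0 ?lexx ?ltr01 // => /(_ isT) fz.
by have := bf _ _ ezt; rewrite fz; case: (f s); case: (odd k); case: (f t).
Qed.

Lemma bipartite_time (f : T -> bool) : coloring f ->
  exists J, forall s t, (0 < walk e (0 : R) s J.*2 t) = (f s == f t).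
Proof.
move=> bf; have [J HJ] : exists J, forall s t, f s == f t -> 0 < walk e (0:R) s J.*2 t.
  apply: (uniform_time 0 (lexx _) ltr01).
  move=> s t /eqP fst; have [k hk] := walk_reach 0 (lexx _) ltr01 s t.
  exists k./2; have := walk_parity f k s t bf hk.
  rewrite fst => ok; have {}ok : odd k = false by case: (f t) (odd k) ok => [] [].
  by move: (odd_double_half k); rewrite ok add0n => ->.
exists J => s t; apply/idP/idP; last exact: HJ.
by move=> /(walk_parity f _ _ _ bf) ->; rewrite odd_double addbF.
Qed.

(** * Convergence to equilibrium *)

Definition norm1 (x : T -> R) : R := \sum_t `|x t|.

Lemma norm1_ge0 x : 0 <= norm1 x.
Proof. by apply: sumr_ge0 => t _. Qed.

Lemma le_norm1 x t : `|x t| <= norm1 x.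
Proof. by rewrite /norm1 (bigD1 t) //= lerDl sumr_ge0. Qed.

Lemma norm1B x y : norm1 (fun t => x t - y t) <= norm1 x + norm1 y.
Proof. by rewrite /norm1 -big_split; apply: ler_sum => t _; exact: ler_normB. Qed.

Lemma norm1_evol g k x : 0 <= g -> g < 1 -> norm1 (evol g k x) <= norm1 x.
Proof.
move=> g0 g1; rewrite /norm1.
apply: (@le_trans _ _ (\sum_t \sum_s `|x s| * walk e g s k t)).
  apply: ler_sum => t _; rewrite evolE; apply: le_trans (ler_norm_sum _ _ _) _.
  by apply: ler_sum => s _; rewrite normrM (ger0_norm (walk_ge0 _ g0 g1 _ _ _)).
rewrite exchange_big; apply: ler_sum => s _.
by rewrite -mulr_sumr sum_walk mulr1.
Qed.

Lemma norm1_evol_le g j k x : 0 <= g -> g < 1 -> (j <= k)%N ->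
  norm1 (evol g k x) <= norm1 (evol g j x).
Proof. by move=> g0 g1 /subnK <-; rewrite evolD norm1_evol. Qed.

(** An explicit rate for the decay of [(1 - d) ^+ m], so that the Archimedean property suffices
    later. Induction uses [(1 - d) * (1 + (m + 1) * d) <= 1 + m * d]. *)
Lemma geometric_le_harmonic (d : R) m : 0 <= d <= 1 ->
  (1 - d) ^+ m * (1 + m%:R * d) <= 1.
Proof.
case/andP=> d0 d1; elim: m => [|m IH]; first by rewrite expr0 mul0r addr0 mulr1.
apply: le_trans IH; rewrite exprS [_ * _ ^+ _]mulrC -mulrA ler_wpM2l //.
  by rewrite exprn_ge0 // subr_ge0.
have : 0 <= m.+1%:R * d * d by rewrite !mulr_ge0.
by rewrite -natr1; lra.
Qed.

(** * Contraction on zero-sum data; [c] will be constant or a 2-colouring *)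

Section Contraction.
Variables (g : R) (J : nat) (c : T -> bool).
Hypotheses (g0 : 0 <= g) (g1 : g < 1).
Hypothesis cJ : forall s t, (0 < walk e g s J t) = (c s == c t).

Lemma class_sum_evol x i :
  \sum_(t | c t == i) evol g J x t = \sum_(t | c t == i) x t.
Proof.
under eq_bigr do rewrite evolE.
rewrite exchange_big /= [RHS]big_mkcond /=; apply: eq_bigr => s _.
have walk0 t : c s != c t -> walk e g s J t = 0.
  by rewrite -cJ lt0r walk_ge0 // andbT negbK => /eqP.
rewrite -mulr_sumr; case: eqP => csi; last first.
  rewrite big1 ?mulr0 // => t /eqP cti; apply: walk0.
  by rewrite cti; apply/eqP.
rewrite -[RHS]mulr1 -(sum_walk g s J); congr (_ * _).
rewrite [LHS]big_mkcond; apply: eq_bigr => t _; case: eqP => // cti.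
by rewrite walk0 // csi eq_sym; apply/eqP.
Qed.

(* Doeblin: subtract the uniform lower bound [d] of the kernel on each class. *)
Lemma contraction : exists2 d : R, 0 < d <= 1 & forall x,
  (forall i, \sum_(t | c t == i) x t = 0) ->
  norm1 (evol g J x) <= (1 - d) * norm1 x.
Proof.
have [d /andP [d0 d1] dP] : exists2 d : R, 0 < d <= 1 &
    forall s t, d * (c s == c t)%:R <= walk e g s J t.
  exists (\big[Num.min/1]_(p : T * T | c p.1 == c p.2) walk e g p.1 J p.2).
    by rewrite bigmin_le_id andbT lt_bigmin ?ltr01 // => p; rewrite cJ.
  move=> s t; case: (boolP (c s == c t)) => cst; last by rewrite mulr0 walk_ge0.
  by rewrite mulr1; exact: (bigmin_le_cond _ (j := (s, t))).
exists d => [|x x0]; first by rewrite d0.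
apply: (@le_trans _ _
    (\sum_t \sum_s `|x s| * (walk e g s J t - d * (c s == c t)%:R))).
  apply: ler_sum => t _.
  (* The subtracted term contributes nothing because [x] sums to zero on every class. *)
  have -> : evol g J x t = \sum_s x s * (walk e g s J t - d * (c s == c t)%:R).
    rewrite evolE; under [RHS]eq_bigr do rewrite mulrBr.
    rewrite sumrB [X in _ - X](_ : _ = 0) ?subr0 //.
    transitivity (d * \sum_(s | c s == c t) x s); last by rewrite x0 mulr0.
    rewrite mulr_sumr [RHS]big_mkcond; apply: eq_bigr => s _.
    by case: eqP => _; rewrite ?mulr1 ?mulr0 // mulrC.
  apply: le_trans (ler_norm_sum _ _ _) _; apply: ler_sum => s _.
  by rewrite normrM [X in _ * X]ger0_norm // subr_ge0.
rewrite exchange_big mulr_sumr; apply: ler_sum => s _.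
rewrite -mulr_sumr mulrC ler_wpM2r // sumrB sum_walk lerB //.
(* The class of [s] contains [s], so the reduced row sums to at most [1 - d]. *)
rewrite (bigD1 s) //= eqxx mulr1 lerDl sumr_ge0 // => t _.
by rewrite mulr_ge0 // ltW.
Qed.

Lemma evol_cvg0 x : (forall i, \sum_(t | c t == i) x t = 0) ->
  forall eps, 0 < eps ->
  exists N, forall k, (N <= k)%N -> norm1 (evol g k x) <= eps.
Proof.
move=> x0 eps eps0; have [d /andP [d0 d1] dP] := contraction.
pose m := Num.bound (norm1 x / (eps * d)).
exists (m * J)%N => k /(norm1_evol_le _ _ _ x g0 g1) /le_trans; apply.
have mE : norm1 (evol g (m * J) x) <= (1 - d) ^+ m * norm1 x /\
    forall i, \sum_(t | c t == i) evol g (m * J) x t = 0.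
  elim: (m) => [|n [IH1 IH2]]; first by rewrite expr0 mul1r.
  rewrite mulSn evolD; split=> [|i]; last by rewrite class_sum_evol.
  apply: le_trans (dP _ IH2) _.
  by rewrite exprS -mulrA ler_wpM2l // subr_ge0.
apply: le_trans mE.1 _.
have md : 0 < 1 + m%:R * d by rewrite ltr_pwDl // mulr_ge0 // ltW.
have := @geometric_le_harmonic d m; rewrite ltW // d1 => /(_ isT) H.
rewrite -(ler_pM2r md) mulrAC; apply: le_trans (ler_wpM2r (norm1_ge0 x) H) _.
rewrite mul1r.
have : norm1 x / (eps * d) < m%:R.
  by apply: archi_boundP; rewrite divr_ge0 ?norm1_ge0 // mulr_ge0 // ltW.
by rewrite ltr_pdivrMr ?mulr_gt0 // => /ltW h; apply: le_trans h _; lra.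
Qed.

End Contraction.

(** * Kernels of powers of the step operator *)

Lemma step_self_adjoint g x y :
  \sum_t step g x t * y t / (deg e t)%:R = \sum_t x t * step g y t / (deg e t)%:R.
Proof.
rewrite /step; under eq_bigr do rewrite -mulrA mulr_suml.
rewrite exchange_big; apply: eq_bigr => s _.
rewrite mulr_sumr mulr_suml; apply: eq_bigr => t _.
have := kernel_rev g s t => H.
have -> : kernel g s t = (deg e t)%:R * kernel g t s / (deg e s)%:R.
  by rewrite -H mulrAC mulfV ?mul1r ?deg_neq0.
by field; rewrite !deg_neq0.
Qed.

(** By self-adjointness the weighted square norm of [step g x] is the pairing of [x] with
    [step g (step g x)]. *)
Lemma step_ker2 g x : (forall t, step g (step g x) t = 0) ->
  forall t, step g x t = 0.
Proof.
move=> H t; have : \sum_t step g x t * step g x t / (deg e t)%:R == 0.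
  by rewrite step_self_adjoint; apply/eqP/big1 => s _; rewrite H mulr0 mul0r.
rewrite psumr_eq0; last first.
  by move=> s _; rewrite divr_ge0 ?ler0n // -expr2 sqr_ge0.
move=> /allP /(_ t (mem_index_enum t)) /=.
by rewrite !mulf_eq0 invr_eq0 (negPf (deg_neq0 t)) orbF orbb => /eqP.
Qed.

(* The step operator is self-adjoint for the weight [1 / deg], so its powers
   have the same kernel as the operator itself. *)
Lemma evol_ker g k x : (forall t, evol g k.+1 x t = 0) ->
  forall t, step g x t = 0.
Proof.
elim: k => [|k IH] // H; apply: IH => t.
by rewrite /evol iterS; apply: step_ker2 => s; rewrite -!iterS; apply: H.
Qed.
(** * Graph distance and Wasserstein distance *)

Lemma gdist_refl x : gdist e x x = 0%N.
Proof. by rewrite /gdist; case: #|T| T2 => [|n] //= _; rewrite inE eqxx. Qed.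

Lemma gdist_gt0 x y : x != y -> (0 < gdist e x y)%N.
Proof.
rewrite /gdist eq_sym; case: #|T| T2 => [|n] //= _ /negPf xy.
by rewrite inE xy.
Qed.

Lemma gdist_edge x y : e x y -> (gdist e x y <= 1)%N.
Proof.
move=> exy; rewrite /gdist; case: #|T| T2 => [|[|n]] //= _.
have -> : y \in [set x]%SET :|: \bigcup_(z in [set x]%SET) nbhd e z.
  by rewrite big_set1 !inE exy orbT.
by case: ifP.
Qed.

Lemma gdist_le_card x y : (gdist e x y <= #|T|)%N.
Proof. by rewrite -[X in (_ <= X)%N](size_iota 0) find_size. Qed.

Lemma ball_path x p : path e x p -> last x p \in ball e (size p) x.
Proof.
elim/last_ind: p => [|p y IH]; first by rewrite /= inE.
rewrite rcons_path last_rcons size_rcons => /andP [/IH pp ey] /=.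
by rewrite inE; apply/orP; right; apply/bigcupP; exists (last x p); rewrite ?inE.
Qed.

(** Balls are cumulative, so only the first radius reaching [y] has a determined parity. A neighbour
    of [y] in the previous ball is itself first reached there, since otherwise [y] would be reached
    sooner. *)
Lemma ball_parity (f : T -> bool) x n y : coloring f ->
  y \in ball e n x -> (forall i, (i < n)%N -> y \notin ball e i x) ->
  f y = f x (+) odd n.
Proof.
move=> bf; elim: n y => [|n IH] y.
  by rewrite /= inE => /eqP -> _; rewrite addbF.
move=> yn ymin; move: yn; rewrite /= inE (negPf (ymin n _)) //= => /bigcupP [z zn].
rewrite inE => ezy; have := bf _ _ ezy; rewrite (IH z zn); last first.
  move=> i lin; apply/negP => zi; have /negP := ymin i.+1 lin; apply.
  by rewrite /= inE; apply/orP; right; apply/bigcupP; exists z; rewrite ?inE.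
by case: (f x); case: (odd n); case: (f y).
Qed.

Lemma gdist_parity (f : T -> bool) x y : coloring f ->
  odd (gdist e x y) = (f x != f y).
Proof.
(* A path without repeated vertices has fewer than [#|T|] edges, so the search in [gdist] succeeds
   and never returns its default. *)
move=> bf; have xy : has (fun n => y \in ball e n x) (iota 0 #|T|).
  have /connectP [p0 ep0 ->] := cg x y; case/shortenP: ep0 => p ep up _.
  apply/hasP; exists (size p); last exact: ball_path.
  by rewrite mem_iota add0n /= -[(size p).+1]/(size (x :: p)) -(card_uniqP up) max_card.
have lt : (gdist e x y < #|T|)%N by move: xy; rewrite has_find size_iota.
have := @ball_parity f x (gdist e x y) y bf.
have := nth_find 0%N xy; rewrite -/(gdist e x y) nth_iota // add0n => -> /(_ isT) ->.
  by case: (f x); case: odd.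
move=> i li; have := before_find 0%N li; rewrite nth_iota ?add0n ?(ltn_trans li lt) //.
by move=> ->.
Qed.

Section Wasserstein.
Variables mu nu : T -> R.

Lemma transport_cost_ge0 P : transport_plan mu nu P -> 0 <= transport_cost e P.
Proof.
by case=> P0 _; apply: sumr_ge0 => x _; apply: sumr_ge0 => y _; rewrite mulr_ge0.
Qed.

Lemma wasserstein_le P : transport_plan mu nu P ->
  wasserstein e mu nu <= transport_cost e P.
Proof.
move=> hP; apply: ge_inf; last by exists P.
by exists 0 => _ [Q [/transport_cost_ge0 ? ->]].
Qed.

Hypotheses (mu0 : forall t, 0 <= mu t) (nu0 : forall t, 0 <= nu t).
Hypotheses (mu1 : \sum_t mu t = 1) (nu1 : \sum_t nu t = 1).

Lemma wasserstein_ge c :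
  (forall P, transport_plan mu nu P -> c <= transport_cost e P) ->
  c <= wasserstein e mu nu.
Proof.
move=> h; apply: lb_le_inf => [|_ [P [hP ->]]]; last exact: h.
(* The independent coupling shows that the infimum is over a nonempty set. *)
exists (transport_cost e (fun x y => mu x * nu y)), (fun x y => mu x * nu y).
split=> //; split=> [x y|]; first by rewrite mulr_ge0.
split=> [x|y]; first by rewrite -mulr_sumr nu1 mulr1.
by rewrite -mulr_suml mu1 mul1r.
Qed.

Lemma wasserstein_ge0 : 0 <= wasserstein e mu nu.
Proof. by apply: wasserstein_ge => P; exact: transport_cost_ge0. Qed.

(* The indicator of [A] is 1-Lipschitz for the graph distance. *)
Lemma wasserstein_cut (A : pred T) :
  \sum_(t | A t) mu t - \sum_(t | A t) nu t <= wasserstein e mu nu.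
Proof.
apply: wasserstein_ge => P [P0 [Pmu Pnu]].
have -> : \sum_(t | A t) mu t = \sum_x \sum_y (A x)%:R * P x y.
  rewrite big_mkcond; apply: eq_bigr => x _; rewrite -mulr_sumr Pmu.
  by case: (A x); rewrite ?mul1r ?mul0r.
have -> : \sum_(t | A t) nu t = \sum_x \sum_y (A y)%:R * P x y.
  rewrite exchange_big big_mkcond; apply: eq_bigr => y _; rewrite -mulr_sumr Pnu.
  by case: (A y); rewrite ?mul1r ?mul0r.
rewrite -sumrB; apply: ler_sum => x _; rewrite -sumrB; apply: ler_sum => y _.
rewrite -mulrBl ler_wpM2r //; have [->|/gdist_gt0 xy] := eqVneq x y.
  by rewrite subrr ler0n.
apply: (@le_trans _ _ 1); last by rewrite ler1n.
by case: (A x); case: (A y); rewrite ?mulr1n ?mulr0n; lra.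
Qed.

(** Cuts at single vertices give [mu <= nu] pointwise, and equal total masses then force
    equality. *)
Lemma wasserstein_eq0 : wasserstein e mu nu = 0 -> forall t, mu t = nu t.
Proof.
have le0 : wasserstein e mu nu = 0 -> forall t, mu t <= nu t.
  move=> W0 t; rewrite -subr_le0 -W0.
  by have := wasserstein_cut (pred1 t); rewrite !big_pred1_eq.
move=> W0 t; apply/eqP; rewrite -subr_eq0.
have /eqP : \sum_t (nu t - mu t) = 0 by rewrite sumrB mu1 nu1 subrr.
rewrite psumr_eq0; last by move=> s _; rewrite subr_ge0 le0.
by move=> /allP /(_ t (mem_index_enum t)) /= /eqP h; rewrite -opprB h oppr0.
Qed.

(* The mass common to both distributions stays in place and the two excesses
   are coupled independently; if they vanish, [D = 0] and [_ / D = 0]. *)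
Lemma wasserstein_le_norm1 :
  wasserstein e mu nu <= #|T|%:R * norm1 (fun t => mu t - nu t).
Proof.
pose m t := Num.min (mu t) (nu t).
pose p t := mu t - m t; pose q t := nu t - m t; pose D := \sum_t p t.
have p0 t : 0 <= p t by rewrite subr_ge0 ge_min lexx.
have q0 t : 0 <= q t by rewrite subr_ge0 ge_min lexx orbT.
have Dq : D = \sum_t q t by rewrite /D !sumrB mu1 nu1.
have D0 : 0 <= D by apply: sumr_ge0.
have cancelD f : (forall t, 0 <= f t) -> \sum_t f t = D -> forall t, f t * D / D = f t.
  move=> f0 fD t; have [DE|Dn0] := eqVneq D 0; last by rewrite mulfK.
  rewrite DE mulr0 mul0r; move: fD; rewrite DE => /eqP.
  by rewrite psumr_eq0 // => /allP /(_ t (mem_index_enum t)) /= /eqP.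
pose P x y := (x == y)%:R * m x + p x * q y / D.
have diag (f : T -> R) x : \sum_y (x == y)%:R * f y = f x.
  rewrite -[RHS](sum_point_mass f x); apply: eq_bigr => y _.
  by rewrite /point_mass eq_sym.
have hP : transport_plan mu nu P.
  split=> [x y|]; first by rewrite addr_ge0 ?divr_ge0 ?mulr_ge0 // le_min mu0 nu0.
  split=> [x|y]; rewrite /P big_split /=.
    rewrite -!mulr_suml -mulr_sumr -Dq cancelD //.
    have := diag (fun=> m x) x; rewrite -mulr_suml => ->.
    by rewrite /p addrC subrK.
  have -> : \sum_x p x * q y / D = q y * D / D.
    by rewrite -!mulr_suml mulrC -/D [D * _]mulrC mulrC.
  rewrite cancelD //; under eq_bigr do rewrite eq_sym.
  by rewrite diag /q addrC subrK.
apply: le_trans (wasserstein_le P hP) _.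
apply: (@le_trans _ _ (\sum_x \sum_y #|T|%:R * (p x * q y / D))).
  apply: ler_sum => x _; apply: ler_sum => y _; rewrite /P mulrDr.
  have -> : (gdist e x y)%:R * ((x == y)%:R * m x) = 0 :> R.
    by case: eqP => [->|_]; rewrite ?gdist_refl !mul0r // mulr0.
  by rewrite add0r ler_wpM2r ?divr_ge0 ?mulr_ge0 // ler_nat gdist_le_card.
under eq_bigr do rewrite -mulr_sumr -mulr_suml -mulr_sumr -Dq cancelD //.
rewrite -mulr_sumr ler_wpM2l // /norm1; apply: ler_sum => t _.
rewrite /p /m; case: (leP (mu t) (nu t)) => _; first by rewrite subrr.
exact: ler_norm.
Qed.

End Wasserstein.
(** * Flows and the bipartite case *)

(** A unit flow from [s] to [t], built by superposing one antisymmetric edge flow per step of a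
    path. *)
Lemma path_flow s t : exists F : T -> T -> R,
  [/\ forall x y, F x y = - F y x, forall x y, ~~ e x y -> F x y = 0
    & forall x, \sum_y F x y = point_mass s x - point_mass t x].
Proof.
have /connectP [p ep ->] := cg s t.
elim: p s ep => [|y p IH] s /=.
  by exists (fun _ _ => 0); split=> [x y|//|x]; rewrite ?oppr0 // big1 // subrr.
case/andP=> esy /IH [F [Fa Fe Fd]].
exists (fun x z => F x z + (x == s)%:R * (z == y)%:R - (x == y)%:R * (z == s)%:R).
split=> [x z|x z nexz|x].
- by rewrite (Fa x z); ring.
- rewrite Fe // add0r; apply/eqP; rewrite subr_eq0; apply/eqP.
  case: (eqVneq x s) nexz => [->|xs] nexz.
    case: (eqVneq z y) nexz => [->|zy nexz]; first by rewrite esy.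
    case: (eqVneq s y) esy => [<-|]; first by rewrite (sg.2 s).
    by rewrite mulr0 mul0r.
  rewrite mul0r; case: (eqVneq x y) nexz => [->|xy]; last by rewrite mul0r.
  by case: (eqVneq z s) => [->|]; rewrite ?mulr0 // eC esy.
- rewrite sumrB big_split /= Fd -!mulr_sumr.
  have one w : \sum_z (z == w)%:R = 1 :> R.
    by rewrite (bigD1 w) //= eqxx big1 ?addr0 // => z /negPf ->.
  by rewrite !one /point_mass; ring.
Qed.

(** Each [z s] is sent along a fixed unit flow to a common root, where the arrivals cancel since [z]
    has total zero. The unit flows do not depend on [z], which makes [C] uniform. *)
Lemma zero_sum_flow : exists2 C : R, 0 <= C & forall z : T -> R, \sum_t z t = 0 ->
  exists F : T -> T -> R,
  [/\ forall x y, F x y = - F y x, forall x y, ~~ e x y -> F x y = 0,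
      forall x, \sum_y F x y = z x & forall x y, `|F x y| <= C * norm1 z].
Proof.
have /card_gt0P [r _] : (0 < #|T|)%N by exact: ltnW.
have /choice [Phi HPhi] := fun s => path_flow s r.
exists (\sum_s \sum_x \sum_y `|Phi s x y|).
  by do 3![apply: sumr_ge0 => ? _].
move=> z z0; exists (fun x y => \sum_s z s * Phi s x y); split=> [x y|x y nexy|x|x y].
- by rewrite -sumrN; apply: eq_bigr => s _; have [-> _ _] := HPhi s; rewrite mulrN.
- by apply: big1 => s _; have [_ -> //] := HPhi s; rewrite mulr0.
- rewrite exchange_big /=.
  transitivity (\sum_s (z s * point_mass s x - z s * point_mass r x)).
    apply: eq_bigr => s _; rewrite -mulr_sumr.
    by have [_ _ ->] := HPhi s; rewrite mulrBr.
  rewrite sumrB -mulr_suml z0 mul0r subr0.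
  rewrite -[RHS](sum_point_mass z x); apply: eq_bigr => s _.
  by rewrite /point_mass eq_sym mulrC.
- apply: le_trans (ler_norm_sum _ _ _) _.
  rewrite /norm1 mulr_sumr; apply: ler_sum => s _.
  rewrite normrM mulrC ler_wpM2r //.
  rewrite (bigD1 s) //= (bigD1 x) //= (bigD1 y) //= -!addrA lerDl.
  by rewrite !addr_ge0 //; do ?[apply: sumr_ge0 => ? _].
Qed.

(** * The stationary law and its signed counterpart *)

Definition total_deg : R := \sum_t (deg e t)%:R.

Lemma total_deg_gt0 : 0 < total_deg.
Proof.
have /card_gt0P [r _] : (0 < #|T|)%N by exact: ltnW.
by rewrite /total_deg (bigD1 r) //= ltr_pwDl ?deg_gt0 // sumr_ge0.
Qed.

Definition stationary (t : T) : R := (deg e t)%:R / total_deg.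

Lemma stationary_gt0 t : 0 < stationary t.
Proof. by rewrite divr_gt0 ?deg_gt0 ?total_deg_gt0. Qed.

Lemma sum_stationary : \sum_t stationary t = 1.
Proof. by rewrite -mulr_suml mulfV // gt_eqF // total_deg_gt0. Qed.

Lemma stationary_rev g s t :
  stationary s * kernel g s t = stationary t * kernel g t s.
Proof. by rewrite /stationary mulrAC kernel_rev mulrAC. Qed.

Lemma evol_stationary g k t : evol g k stationary t = stationary t.
Proof.
elim: k t => [|k IH] t //; rewrite /evol iterS /step -/(evol g k _).
under eq_bigr do rewrite IH stationary_rev.
by rewrite -mulr_sumr sum_kernel mulr1.
Qed.

Definition sgn (f : T -> bool) (t : T) : R := (-1) ^+ f t.

Lemma sgn_sqr f t : sgn f t * sgn f t = 1.
Proof. by rewrite -expr2 sqrr_sign. Qed.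

(** The indicator of a colour class is half of [1 + (-1) ^+ i * sgn f]; this reduces class masses to
    the total and the signed mass, both easy to follow in time. *)
Lemma class_sum (f : T -> bool) (x : T -> R) (i : bool) :
  \sum_(t | f t == i) x t = (\sum_t x t + (-1) ^+ i * \sum_t sgn f t * x t) / 2.
Proof.
rewrite mulr_sumr -big_split mulr_suml big_mkcond; apply: eq_bigr => t _ /=.
rewrite /sgn; case: (f t); case: i; rewrite /= ?expr0 ?expr1; lra.
Qed.

Lemma aperiodic_cvg0 g x : 0 <= g -> g < 1 -> 0 < g \/ ~ bipartite e ->
  \sum_t x t = 0 -> forall eps, 0 < eps ->
  exists N, forall k, (N <= k)%N -> norm1 (evol g k x) <= eps.
Proof.
move=> g0 g1 h x0; have [J HJ] := aperiodic_time g g0 g1 h.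
apply: (evol_cvg0 g J.*2 (fun=> true) g0 g1) => [s t|[]]; first by rewrite HJ.
  by rewrite -[RHS]x0; apply: eq_bigl => t; rewrite eqxx.
by rewrite big_pred0.
Qed.

Section Bipartite.
Variable f : T -> bool.
Hypothesis bf : coloring f.

Lemma sgn_edge x y : e x y -> sgn f y = - sgn f x.
Proof. by move=> /bf; rewrite /sgn; case: (f x); case: (f y); rewrite //= ?opprK. Qed.

(** The sign is kept with probability [g] and flipped with probability [1 - g], so [sgn f] is an
    eigenfunction with eigenvalue [g - (1 - g)]. *)
Lemma sum_kernel_sgn g s : \sum_t kernel g s t * sgn f t = (2 * g - 1) * sgn f s.
Proof.
transitivity (\sum_t ((- sgn f s) * kernel g s t
                       + 2 * g * (point_mass s t * sgn f t))).
  apply: eq_bigr => t _; rewrite /kernel /point_mass (eq_sym s t).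
  case: (eqVneq t s) => [->|ts].
    by rewrite (sg.2 s) !mulr1n !mulr0n; ring.
  case: (boolP (e s t)) => [/sgn_edge ->|_]; rewrite ?mulr1n ?mulr0n; ring.
by rewrite big_split /= -!mulr_sumr sum_kernel sum_point_mass; ring.
Qed.

Lemma sum_sgn_evol g k x :
  \sum_t sgn f t * evol g k x t = (2 * g - 1) ^+ k * \sum_t sgn f t * x t.
Proof.
elim: k => [|k IH]; first by rewrite expr0 mul1r.
rewrite exprS -mulrA -IH mulr_sumr /evol iterS /step -/(evol g k _).
under eq_bigr do rewrite mulr_sumr.
rewrite exchange_big /=; apply: eq_bigr => s _.
transitivity (evol g k x s * \sum_t kernel g s t * sgn f t).
  by rewrite mulr_sumr; apply: eq_bigr => t _; ring.
by rewrite sum_kernel_sgn; ring.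
Qed.

(** The eigenvector of the non-lazy step for the eigenvalue -1: the part of the law that keeps
    alternating between the two sides. *)
Definition imbalance (t : T) : R := sgn f t * stationary t.

Lemma evol_imbalance k t : evol 0 k imbalance t = (-1) ^+ k * imbalance t.
Proof.
elim: k t => [|k IH] t; first by rewrite expr0 mul1r.
rewrite /evol iterS /step -/(evol 0 k _).
transitivity ((-1) ^+ k * stationary t * \sum_s kernel 0 t s * sgn f s).
  rewrite mulr_sumr; apply: eq_bigr => s _.
  rewrite IH /imbalance; have := stationary_rev 0 s t => H.
  transitivity ((-1) ^+ k * sgn f s * (stationary s * kernel 0 s t)); first by ring.
  by rewrite H; ring.
by rewrite sum_kernel_sgn /imbalance exprS; ring.
Qed.

Lemma sum_imbalance : \sum_t imbalance t = 0.
Proof.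
have := sum_evol 0 1 imbalance; under eq_bigr do rewrite evol_imbalance.
by rewrite -mulr_sumr expr1; lra.
Qed.

Lemma sum_sgn_imbalance : \sum_t sgn f t * imbalance t = 1.
Proof.
rewrite -sum_stationary; apply: eq_bigr => t _.
by rewrite /imbalance mulrA sgn_sqr mul1r.
Qed.

Lemma sum_sgn_stationary : \sum_t sgn f t * stationary t = 0.
Proof. exact: sum_imbalance. Qed.

Lemma sum_sgn_point_mass w : \sum_t sgn f t * point_mass w t = sgn f w.
Proof. by under eq_bigr do rewrite mulrC; rewrite sum_point_mass. Qed.

Lemma bipartite_cvg0 x : \sum_t x t = 0 -> \sum_t sgn f t * x t = 0 ->
  forall eps, 0 < eps ->
  exists N, forall k, (N <= k)%N -> norm1 (evol 0 k x) <= eps.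
Proof.
move=> x0 sx0; have [J HJ] := bipartite_time f bf.
apply: (evol_cvg0 0 J.*2 f (lexx _) ltr01 HJ) => i.
by rewrite class_sum x0 sx0 mulr0 addr0 mul0r.
Qed.

End Bipartite.

(* Every edge carries the limiting mass [c / total_deg], corrected by a flow
   with divergence [z]; the correction is small enough to keep it nonnegative. *)
Lemma wasserstein_across : exists2 C : R, 0 <= C & forall f c (mu nu : T -> R),
  coloring f -> 0 <= c ->
  (forall t, f t -> mu t = 0) -> (forall t, 0 <= nu t) ->
  \sum_t mu t = \sum_t nu t ->
  C * norm1 (fun t => mu t - nu t - c * imbalance f t) <= c / total_deg ->
  wasserstein e mu nu <= \sum_(t | f t) nu t.
Proof.
have [C C0 HC] := zero_sum_flow; exists C => // f c mu nu bf c0 muf nu0 munu.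
set z := fun t => mu t - nu t - c * imbalance f t => zle.
have z0 : \sum_t z t = 0.
  by rewrite !sumrB munu -mulr_sumr sum_imbalance // subrr mulr0 subrr.
have [F [Fa Fe Fd Fb]] := HC z z0.
(* [Z] moves mass only along edges from the unmarked to the marked side, while [P] also leaves [nu]
   in place on the unmarked side. In the row and column sums of [Z] the background [c / total_deg]
   cancels the term [c * imbalance f] of [z]. *)
pose Z x y : R := (~~ f x && f y)%:R * (c / total_deg * (e x y)%:R + F x y).
pose P x y := Z x y + (x == y)%:R * ((~~ f x)%:R * nu x).
have Z0 x y : 0 <= Z x y.
  rewrite mulr_ge0 //; case: (boolP (e x y)) => [_|/Fe ->]; last by rewrite mulr0 addr0.
  have := Fb x y; rewrite ler_norml => /andP [h _].
  by rewrite mulr1; move: zle h; lra.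
have Ze x y : ~~ e x y -> Z x y = 0.
  by move=> exy; rewrite /Z Fe // (negPf exy) mulr0 addr0 mulr0.
have diag (h : T -> R) x : \sum_y (x == y)%:R * h x = h x.
  by rewrite (bigD1 x) //= eqxx mul1r big1 ?addr0 // => y;
     rewrite eq_sym => /negPf ->; rewrite mul0r.
have diag' (h : T -> R) x : \sum_y (y == x)%:R * h y = h x.
  by rewrite -[RHS](sum_point_mass h x).
have Zrow x : \sum_y Z x y = (~~ f x)%:R * (mu x - nu x).
  rewrite /Z; case: (boolP (f x)) => fx /=.
    by rewrite mul0r big1 // => y _; rewrite mul0r.
  transitivity (\sum_y (c / total_deg * (e x y)%:R + F x y)).
    apply: eq_bigr => y _; case: (boolP (f y)) => fy; first by rewrite mul1r.
    have nexy : ~~ e x y by apply/negP => /bf; rewrite (negPf fx) (negPf fy).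
    by rewrite Fe // (negPf nexy) mulr0 addr0 mulr0.
  rewrite big_split /= -mulr_sumr -degE Fd /z /imbalance /sgn (negPf fx) expr0.
  by rewrite /stationary; ring.
have Zcol y : \sum_x Z x y = (f y)%:R * nu y.
  rewrite /Z; case: (boolP (f y)) => fy; last first.
    by rewrite mul0r big1 // => x _; rewrite andbF mul0r.
  transitivity (\sum_x (c / total_deg * (e y x)%:R - F y x)).
    apply: eq_bigr => x _; rewrite -(Fa x y) eC andbT.
    case: (boolP (f x)) => fx; last by rewrite mul1r.
    have nexy : ~~ e x y by apply/negP => /bf; rewrite fx fy.
    by rewrite Fe // eC (negPf nexy) mulr0 addr0 mulr0.
  rewrite sumrB -mulr_sumr -degE Fd /z /imbalance /sgn fy expr1 /stationary (muf _ fy).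
  by rewrite mul1r; ring.
have hP : transport_plan mu nu P.
  split=> [x y|]; first by apply: addr_ge0 => //; rewrite !mulr_ge0.
  split=> [x|y]; rewrite /P big_split /=.
    rewrite (diag (fun x => (~~ f x)%:R * nu x)) Zrow.
    case: (boolP (f x)) => [/muf ->|_].
      by rewrite !mul0r addr0.
    by rewrite !mul1r subrK.
  rewrite (diag' (fun x => (~~ f x)%:R * nu x)) Zcol.
  by case: (f y); rewrite /= mul0r mul1r ?addr0 ?add0r.
apply: le_trans (wasserstein_le mu nu P hP) _.
(* All moved mass travels distance at most 1, so the cost is at most the amount moved, which is the
   mass of [nu] on the marked side. *)
have -> : \sum_(t | f t) nu t = \sum_x \sum_y Z x y.
  rewrite exchange_big big_mkcond; apply: eq_bigr => y _; rewrite Zcol.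
  by case: (f y); rewrite ?mul1r ?mul0r.
apply: ler_sum => x _; apply: ler_sum => y _; rewrite /P mulrDr.
have -> : (gdist e x y)%:R * ((x == y)%:R * ((~~ f x)%:R * nu x)) = 0 :> R.
  by case: eqP => [->|_]; rewrite ?gdist_refl !mul0r // mulr0.
rewrite addr0; case: (boolP (e x y)) => [exy|/Ze ->]; last by rewrite mulr0.
by rewrite ler_piMl // lern1 gdist_edge.
Qed.
(** * Comparing the two walks *)

Section TwoWalks.
Variables (u v : T) (a b : R).
Hypotheses (a0 : 0 <= a) (ab : a <= b) (b1 : b < 1).

Let b0 : 0 <= b := le_trans a0 ab.
Let a1 : a < 1 := le_lt_trans ab b1.

Lemma sum_point_mass1 w : \sum_t point_mass w t = 1.
Proof. by rewrite -(sum_walk 0 w 0). Qed.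

Lemma W_seq_ge0 k : 0 <= W_seq e u v a b k.
Proof.
apply: wasserstein_ge0; [exact: walk_ge0|exact: walk_ge0| |]; exact: sum_walk.
Qed.

Lemma W_seq_across f : coloring f -> a = 0 ->
  (exists2 c : R, 0 < c & forall eps, 0 < eps -> exists N, forall k, (N <= k)%N ->
    norm1 (fun t => walk e a u k t - walk e b v k t
                    - c * ((-1) ^+ k * sgn f u * imbalance f t)) <= eps) ->
  exists N, forall k, (N <= k)%N ->
    W_seq e u v a b k = (1 - sgn f u * sgn f v * (1 - 2 * b) ^+ k) / 2.
Proof.
move=> bf aE [c c0 cvg].
have [C C0 HC] := wasserstein_across.
have Cp : 0 < C + 1 by rewrite ltr_wpDl.
(* [C] may vanish, hence the denominator [C + 1]. *)
have [|N HN] := cvg (c / total_deg / (C + 1)).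
  by rewrite !divr_gt0 ?total_deg_gt0.
exists N => k /HN le_eps.
(* [h] marks the side that the walk from [u] cannot occupy at time [k]. *)
pose h t := f t (+) (f u (+) odd k).
have bh : coloring h.
  move=> x y /bf; rewrite /h.
  by case: (f x); case: (f y); case: (f u); case: (odd k).
have sgn_h t : sgn h t = (-1) ^+ k * sgn f u * sgn f t.
  by rewrite /sgn /h -[(-1) ^+ k]signr_odd -!signr_addb; congr (_ ^+ nat_of_bool _);
     case: (f t); case: (f u); case: (odd k).
have mu0 t : h t -> walk e a u k t = 0.
  rewrite aE => ht; apply/eqP; apply: contraLR ht => wn0.
  have wp : 0 < walk e (0 : R) u k t.
    by rewrite lt0r wn0 walk_ge0 ?ltr01.
  by rewrite /h (walk_parity f k u t bf wp) addbb.
have nu_h : \sum_(t | h t) walk e b v k t =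
    (1 - sgn f u * sgn f v * (1 - 2 * b) ^+ k) / 2.
  transitivity (\sum_(t | h t == true) walk e b v k t).
    by apply: eq_bigl => t; rewrite eqb_id.
  rewrite class_sum sum_walk expr1.
  have -> : \sum_t sgn h t * walk e b v k t =
      (-1) ^+ k * sgn f u * \sum_t sgn f t * walk e b v k t.
    by rewrite mulr_sumr; apply: eq_bigr => t _; rewrite sgn_h !mulrA.
  rewrite walkE sum_sgn_evol // sum_sgn_point_mass.
  have -> : 1 - 2 * b = (-1) * (2 * b - 1) by ring.
  by rewrite exprMn; ring.
rewrite -nu_h; apply/le_anti/andP; split.
  apply: (HC h c) => // [|t||].
  - exact: ltW.
  - exact: walk_ge0.
  - by rewrite !sum_walk.
  - rewrite (_ : (fun t => _) = fun t => walk e a u k t - walk e b v k t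
                    - c * ((-1) ^+ k * sgn f u * imbalance f t)); last first.
      by apply/funext => t; rewrite /imbalance sgn_h !mulrA.
    apply: le_trans (ler_wpM2l C0 le_eps) _.
    rewrite mulrCA ler_piMr ?divr_ge0 ?ltW ?total_deg_gt0 //.
    by rewrite ltr_pdivrMr // mul1r ltrDl.
(* For the lower bound, cut at the side carrying the whole first law. *)
have nh_mu : \sum_(t | ~~ h t) walk e a u k t = 1.
  rewrite -(sum_walk a u k) big_mkcond; apply: eq_bigr => t _.
  by case: (boolP (h t)) => // /mu0 ->.
have nh_nu : \sum_(t | ~~ h t) walk e b v k t = 1 - \sum_(t | h t) walk e b v k t.
  by have := sum_walk b v k; rewrite (bigID h) /= => <-; rewrite addrAC subrr add0r.
have := @wasserstein_cut (walk e a u k) (walk e b v k).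
move=> /(_ (walk_ge0 _ a0 a1 _ _) (walk_ge0 _ b0 b1 _ _)).
move=> /(_ (sum_walk _ _ _) (sum_walk _ _ _) (predC h)).
by rewrite /W_seq /= nh_mu nh_nu opprB addrCA subrr addr0.
Qed.

Lemma W_seq_bipartite f : coloring f -> a = 0 -> 0 < b \/ f u != f v ->
  exists N, forall k, (N <= k)%N ->
    W_seq e u v a b k = (1 - sgn f u * sgn f v * (1 - 2 * b) ^+ k) / 2.
Proof.
move=> bf aE bv; apply: (W_seq_across f bf aE).
(* For [b = 0] both walks alternate on opposite sides and their oscillations add up, giving the
   amplitude 2. For [b > 0] the second walk equilibrates and only the first oscillates. *)
have [bE|bn0] := eqVneq b 0; [exists 2 | exists 1] => //.
  have fuv : f u != f v by case: bv => //; rewrite bE ltxx.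
  pose x t := point_mass u t - point_mass v t - 2 * (sgn f u * imbalance f t).
  have x0 : \sum_t x t = 0.
    by rewrite !sumrB !sum_point_mass1 -!mulr_sumr sum_imbalance //; ring.
  have sx0 : \sum_t sgn f t * x t = 0.
    under eq_bigr do rewrite !mulrBr.
    rewrite !sumrB !sum_sgn_point_mass.
    under [X in _ - X]eq_bigr do rewrite mulrCA (mulrCA (sgn f _)).
    rewrite -!mulr_sumr sum_sgn_imbalance.
    by move: fuv; rewrite /sgn; case: (f u); case: (f v); rewrite //= => _; ring.
  move=> eps /(bipartite_cvg0 f bf x x0 sx0) [N HN]; exists N => k /HN.
  congr (norm1 _ <= _); apply/funext => t.
  rewrite evolB evolB evolZ evolZ evol_imbalance // -!walkE aE bE; ring.
have bp : 0 < b by rewrite lt0r bn0.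
pose x t := point_mass u t - stationary t - sgn f u * imbalance f t.
pose y t := point_mass v t - stationary t.
have x0 : \sum_t x t = 0.
  by rewrite !sumrB sum_point_mass1 sum_stationary -mulr_sumr sum_imbalance //; ring.
have sx0 : \sum_t sgn f t * x t = 0.
  under eq_bigr do rewrite !mulrBr.
  rewrite !sumrB sum_sgn_point_mass sum_sgn_stationary //.
  under [X in _ - X]eq_bigr do rewrite mulrCA.
  by rewrite -!mulr_sumr sum_sgn_imbalance; ring.
have y0 : \sum_t y t = 0 by rewrite sumrB sum_point_mass1 sum_stationary subrr.
move=> eps eps0; have eps2 : 0 < eps / 2 by rewrite divr_gt0.
have [N1 H1] := bipartite_cvg0 f bf x x0 sx0 _ eps2.
have [N2 H2] := aperiodic_cvg0 b y b0 b1 (or_introl bp) y0 _ eps2.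
exists (maxn N1 N2) => k; rewrite geq_max => /andP [/H1 h1 /H2 h2].
have -> : (fun t => walk e a u k t - walk e b v k t
    - 1 * ((-1) ^+ k * sgn f u * imbalance f t))
  = (fun t => evol 0 k x t - evol b k y t).
  apply/funext => t; rewrite !evolB evolZ evol_imbalance // !evol_stationary.
  by rewrite -!walkE aE; ring.
by apply: le_trans (norm1B _ _) _; move: h1 h2; lra.
Qed.

(** The distance is at most [#|T|] times the 1-norm, so it tends to 0; an eventually constant value
    must then be 0, and distance 0 means equal laws. *)
Lemma W_seq_cvg0_meet :
  (forall eps, 0 < eps -> exists N, forall k, (N <= k)%N ->
     norm1 (fun t => walk e a u k t - walk e b v k t) <= eps) ->
  eventually_constant (W_seq e u v a b) ->
  exists N, forall k t, (N <= k)%N -> walk e a u k t = walk e b v k t.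
Proof.
move=> cvg [N HN]; exists N => k t Nk.
suff WN0 : W_seq e u v a b N = 0.
  have := @wasserstein_eq0 (walk e a u k) (walk e b v k).
  move=> /(_ (walk_ge0 _ a0 a1 _ _) (walk_ge0 _ b0 b1 _ _)).
  by apply; rewrite ?sum_walk // -[RHS]WN0 -(HN k Nk).
have T0 : 0 < #|T|%:R :> R by rewrite ltr0n ltnW.
apply/eqP; rewrite eq_le W_seq_ge0 andbT leNgt; apply/negP => Wp.
have [|M HM] := cvg (W_seq e u v a b N / 2 / #|T|%:R); first by rewrite !divr_gt0.
have := HM _ (leq_maxr N M); set k' := maxn N M => le_eps.
have := @wasserstein_le_norm1 (walk e a u k') (walk e b v k').
move=> /(_ (walk_ge0 _ a0 a1 _ _) (walk_ge0 _ b0 b1 _ _)).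
move=> /(_ (sum_walk _ _ _) (sum_walk _ _ _)).
rewrite -[wasserstein _ _ _]/(W_seq e u v a b k') (HN k') ?leq_maxl // => h.
have : W_seq e u v a b N <= W_seq e u v a b N / 2.
  apply: le_trans h _; rewrite mulrC -ler_pdivlMr //.
by move: Wp; lra.
Qed.

Lemma aperiodic_meet : 0 < a \/ ~ bipartite e ->
  eventually_constant (W_seq e u v a b) ->
  exists N, forall k t, (N <= k)%N -> walk e a u k t = walk e b v k t.
Proof.
move=> ap; apply: W_seq_cvg0_meet => eps eps0.
have bp : 0 < b \/ ~ bipartite e.
  by case: ap => [/lt_le_trans h|]; [left; exact: h|right].
have eps2 : 0 < eps / 2 by rewrite divr_gt0.
have z0 w : \sum_t (point_mass w t - stationary t) = 0.
  by rewrite sumrB sum_point_mass1 sum_stationary subrr.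
have [N1 H1] := aperiodic_cvg0 a _ a0 a1 ap (z0 u) _ eps2.
have [N2 H2] := aperiodic_cvg0 b _ b0 b1 bp (z0 v) _ eps2.
exists (maxn N1 N2) => k; rewrite geq_max => /andP [/H1 h1 /H2 h2].
have -> : (fun t => walk e a u k t - walk e b v k t)
  = (fun t => evol a k (fun s => point_mass u s - stationary s) t
            - evol b k (fun s => point_mass v s - stationary s) t).
  by apply/funext => t; rewrite !evolB !evol_stationary -!walkE; ring.
by apply: le_trans (norm1B _ _) _; move: h1 h2; lra.
Qed.

Lemma bipartite_meet f : coloring f -> a = 0 -> b = 0 -> f u = f v ->
  eventually_constant (W_seq e u v a b) ->
  exists N, forall k t, (N <= k)%N -> walk e a u k t = walk e b v k t.
Proof.
move=> bf aE bE fuv; apply: W_seq_cvg0_meet => eps eps0.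
have [||N HN] := bipartite_cvg0 f bf
  (fun s => point_mass u s - point_mass v s) _ _ _ eps0.
- by rewrite sumrB !sum_point_mass1 subrr.
- under eq_bigr do rewrite mulrBr.
  by rewrite sumrB !sum_sgn_point_mass /sgn fuv subrr.
exists N => k /HN; rewrite aE bE.
congr (norm1 _ <= _); apply/funext => t.
by rewrite evolB -!walkE.
Qed.

End TwoWalks.

(** * From coinciding laws to conditions on neighbourhoods, and back *)

Lemma step_point_mass g w t : step g (point_mass w) t = kernel g w t.
Proof. exact: sum_point_mass. Qed.

(** The difference of the two point masses is annihilated by [N.+1] steps, hence by [evol_ker]
    already by one. *)
Lemma kernel_eq_of_meet (g : R) (u v : T) N :
  (forall t, walk e g u N.+1 t = walk e g v N.+1 t) ->
  forall t, kernel g u t = kernel g v t.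
Proof.
move=> H t; apply/eqP; rewrite -subr_eq0.
have E s : step g (fun s => point_mass u s - point_mass v s) s
    = kernel g u s - kernel g v s.
  by rewrite -[LHS]/(evol g 1 _ s) evolB -!walkE !walk1E.
rewrite -E; apply/eqP; apply: (evol_ker g N) => s.
by rewrite evolB -!walkE H subrr.
Qed.

Lemma walk_eq_of_kernel (g : R) (u v : T) k :
  (forall t, kernel g u t = kernel g v t) ->
  walk e g u k.+1 = walk e g v k.+1.
Proof.
move=> H; rewrite !walkE /evol !iterSr; congr iter.
by apply/funext => t; rewrite !step_point_mass H.
Qed.

Lemma meet_eventually_constant (u v : T) (a : R) : 0 <= a -> a < 1 ->
  (forall t, kernel a u t = kernel a v t) ->
  eventually_constant (W_seq e u v a a).
Proof.
move=> a0 a1 H; exists 1%N => -[|k] // _.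
suff W0 j : W_seq e u v a a j.+1 = 0 by rewrite !W0.
apply/le_anti; rewrite W_seq_ge0 // andbT /W_seq (walk_eq_of_kernel a u v j H).
have w0 := walk_ge0 a a0 a1 v j.+1; have w1 := sum_walk a v j.+1.
apply: le_trans (wasserstein_le_norm1 _ _ w0 w0 w1 w1) _.
by rewrite /norm1 big1 ?mulr0 // => t _; rewrite subrr normr0.
Qed.

Lemma kernel_self (g : R) w : kernel g w w = g.
Proof. by rewrite /kernel eqxx (sg.2 w) mulr0 addr0 mulr1. Qed.

Lemma kernel_neq (g : R) s t : s != t ->
  kernel g s t = (1 - g) / (deg e s)%:R * (e s t)%:R.
Proof. by move=> /negPf st; rewrite /kernel st mulr0 add0r. Qed.

Lemma kernel_stationary_star (g : R) w :
  (forall t, kernel g w t = stationary t) ->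
  deg e w = #|T|.-1 /\ g = (deg e w)%:R / total_deg.
Proof.
move=> H; split; last by rewrite -[LHS](kernel_self g w) H.
rewrite /deg -(cardsC1 w); apply: eq_card => t; rewrite !inE.
have [->|tw] := eqVneq t w; first by rewrite (sg.2 w).
apply/idP; have := stationary_gt0 t; rewrite -H kernel_neq 1?eq_sym //.
by case: (e w t) => //; rewrite mulr0 ltxx.
Qed.

(* Once the two walks agree at two consecutive times, their common law is
   stationary, hence already attained after one step; then [u] and [v] are
   adjacent to every other vertex, and [a], [b] are their stationary masses. *)
Lemma meet_laziness_eq (u v : T) (a b : R) N : 0 <= a -> a < b -> b < 1 ->
  0 < a \/ ~ bipartite e ->
  (forall k t, (N <= k)%N -> walk e a u k t = walk e b v k t) -> False.
Proof.
move=> a0 ab b1 ap H; have a1 := lt_trans ab b1.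
pose rho := walk e a u N.+1.
have rho_b : walk e b v N.+1 = rho by apply/funext => t; rewrite /rho H.
have stepS (g : R) t :
    step g rho t = g * rho t + (1 - g) * \sum_(s | e s t) rho s / (deg e s)%:R.
  rewrite stepE mulr_sumr; congr (_ + _).
  by apply: eq_bigr => s _; rewrite mulrAC mulrA.
have rhoE t : rho t = \sum_(s | e s t) rho s / (deg e s)%:R.
  (* Both sides are the common law at time [N.+2]; as [a] and [b] differ, comparing them shows that
     the non-lazy step fixes [rho]. *)
  have E : step a rho t = step b rho t.
    have := H N.+2 t (leqW (leqnSn N)).
    rewrite (walkE a u) (walkE b v) /evol !(iterS N.+1) -!/(evol _ _ _) -!walkE.
    by rewrite rho_b.
  move: E; rewrite !stepS; set S := \sum_(s | _) _ => E.
  have : (b - a) * (rho t - S) == 0 by apply/eqP; move: E; lra.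
  by rewrite mulf_eq0 !subr_eq0 (gt_eqF ab) => /eqP.
have rho_fix k : evol a k rho = rho.
  elim: k => [|k IH] //; rewrite /evol iterS -/(evol _ _ _) IH.
  by apply/funext => t; rewrite stepS -rhoE; ring.
have rho_stat t : rho t = stationary t.
  apply/eqP; rewrite -subr_eq0 -normr_eq0; apply/eqP/le_anti; rewrite normr_ge0 andbT.
  apply/ler_addgt0Pr => eps eps0; rewrite add0r.
  have rho0 : \sum_t (rho t - stationary t) = 0.
    by rewrite sumrB sum_walk sum_stationary subrr.
  have [M /(_ M (leqnn M))] := aperiodic_cvg0 a _ a0 a1 ap rho0 eps eps0.
  apply: le_trans; apply: le_trans (le_norm1 _ t).
  by rewrite evolB rho_fix evol_stationary.
have star (g : R) w : walk e g w N.+1 = rho -> forall t, kernel g w t = stationary t.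
  move=> wE t; apply/eqP; rewrite -subr_eq0 -walk1E walkE -(evol_stationary g 1).
  rewrite -evolB; apply/eqP; apply: (evol_ker g N) => s.
  by rewrite evolB -walkE wE rho_stat evol_stationary subrr.
have [du aE] := kernel_stationary_star a u (star a u erefl).
have [dv bE] := kernel_stationary_star b v (star b v rho_b).
by move: ab; rewrite {1}aE {1}bE du dv ltxx.
Qed.

(** For distinct [u] and [v], evaluating the kernels at [u] and at [v] compares staying put with
    crossing the edge, which determines [a]; the other vertices compare the neighbourhoods. *)
Lemma kernel_eq_cases (u v : T) (a : R) : a < 1 ->
  (forall t, kernel a u t = kernel a v t) ->
  [\/ a = 0 /\ nbhd e u = nbhd e v,
      [/\ a = 1 / ((deg e u).+1)%:R, e u v & nbhd e u :\ v = nbhd e v :\ u]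
    | u = v].
Proof.
move=> a1 H; have [->|uv] := eqVneq u v; first exact: Or33.
have q0 w : 0 < (1 - a) / (deg e w)%:R by rewrite divr_gt0 ?deg_gt0 // subr_gt0.
have same t : t != u -> t != v -> e u t = e v t.
  move=> tu tv; have := H t; rewrite !kernel_neq 1?eq_sym //.
  case: (e u t); case: (e v t) => //; rewrite mulr1 mulr0.
    by move=> h; have := q0 u; rewrite h ltxx.
  by move=> h; have := q0 v; rewrite -h ltxx.
have Hu : a = (1 - a) / (deg e v)%:R * (e u v)%:R.
  by rewrite -[LHS](kernel_self a u) H kernel_neq 1?eq_sym // eC.
have Hv : a = (1 - a) / (deg e u)%:R * (e u v)%:R.
  by rewrite -[LHS](kernel_self a v) -H kernel_neq.
case: (boolP (e u v)) => euv; last first.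
  apply: Or31; split; first by rewrite Hu (negPf euv) mulr0.
  apply/setP => t; rewrite !inE.
  have [->|tu] := eqVneq t u; first by rewrite (sg.2 u) eC (negPf euv).
  have [->|tv] := eqVneq t v; first by rewrite (sg.2 v) (negPf euv).
  exact: same.
apply: Or32; split=> //.
  move: Hv; rewrite euv mulr1 => /(congr1 ( *%R^~ (deg e u)%:R)).
  rewrite divfK ?deg_neq0 // => h.
  have d0 : 0 < (deg e u)%:R + 1 :> R by rewrite ltr_pwDl ?deg_gt0.
  rewrite -natr1; apply: (canRL (mulfK (lt0r_neq0 d0))).
  by move: h; lra.
apply/setP => t; rewrite !inE.
have [->|tu] := eqVneq t u; first by rewrite (sg.2 u) !andbF.
have [->|tv] := eqVneq t v; first by rewrite (sg.2 v).
by rewrite /= same.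
Qed.

Lemma kernel_eq_nbhd (u v : T) : nbhd e u = nbhd e v ->
  forall t, kernel 0 u t = kernel 0 v t.
Proof.
move=> H t; rewrite /kernel !mul0r !add0r /deg H.
by have /setP /(_ t) := H; rewrite !inE => ->.
Qed.

Lemma kernel_eq_twins (u v : T) (a : R) : a = 1 / ((deg e u).+1)%:R -> e u v ->
  nbhd e u :\ v = nbhd e v :\ u -> forall t, kernel a u t = kernel a v t.
Proof.
move=> aE euv H t.
have uv : u != v by apply: contraTN euv => /eqP ->; rewrite (sg.2 v).
have dd : deg e u = deg e v.
  rewrite /deg (cardsD1 v) H (cardsD1 u (nbhd e v)) !inE euv eC euv.
  by [].
have aE' : a = (1 - a) / (deg e u)%:R.
  rewrite aE -natr1; have := deg_gt0 u; set d := (deg e u)%:R => d0.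
  by field; rewrite !gt_eqF // ltr_pwDl.
have [->|tu] := eqVneq t u.
  by rewrite kernel_self kernel_neq 1?eq_sym // eC euv mulr1 -dd.
have [->|tv] := eqVneq t v.
  by rewrite kernel_self kernel_neq // euv mulr1 -aE'.
rewrite !kernel_neq 1?eq_sym // dd.
by have /setP /(_ t) := H; rewrite !inE tu tv /= => ->.
Qed.
End LazyWalk.

Theorem theorem8p2 (R : realType) (T : finType) (e : rel T)
    (u v : T) (a b : R) :
  simple_graph e -> connected_graph e -> (1 < #|T|)%N ->
  0 <= a -> a <= b -> b <= 1 -> b < 1 ->
  eventually_constant (W_seq e u v a b) <->
  ([/\ a = 0, b = 0, bipartite e & odd (gdist e u v)] \/
   [/\ a = 0, b = 1 / 2 & bipartite e] \/
   [/\ a = 0, b = 0 & nbhd e u = nbhd e v] \/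
      [/\ a = 1 / ((deg e u).+1)%:R, b = 1 / ((deg e u).+1)%:R, e u v
        & nbhd e u :\ v = nbhd e v :\ u] \/
   (a = b /\ u = v)).
Proof.
move=> sg cg T2 a0 ab _ b1; have a1 := le_lt_trans ab b1.
have b0 := le_trans a0 ab.
split=> [ec|].
  set goal := (_ \/ _).
  have meet N : a = b ->
      (forall k t, (N <= k)%N -> walk e a u k t = walk e b v k t) -> goal.
    rewrite /goal => <- H.
    have kE := kernel_eq_of_meet _ _ _ sg cg T2 _ _ _ _ (fun t => H N.+1 t (leqnSn N)).
    have [[aE ?]|[aE ? ?]|uv] := kernel_eq_cases _ _ _ sg cg T2 _ _ _ a1 kE.
    - by right; right; left.
    - by right; right; right; left.
    - by right; right; right; right.
  have [ap|nap] := pselect (0 < a \/ ~ bipartite e).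
    have [N HN] := aperiodic_meet _ _ _ sg cg T2 _ _ _ _ a0 ab b1 ap ec.
    apply: (meet N _ HN); move: ab; rewrite le_eqVlt => /orP [/eqP //|ltab]; exfalso.
    exact: (meet_laziness_eq _ _ _ sg cg T2 _ _ _ _ _ a0 ltab b1 ap HN).
  have aE : a = 0.
    apply/le_anti; rewrite a0 andbT leNgt; apply/negP => ap.
    by apply: nap; left.
  have [f bf] : bipartite e by apply: contrapT => nb; apply: nap; right.
  have [[bE /eqP fuv]|bv] := pselect (b = 0 /\ f u == f v).
    have [N HN] := bipartite_meet _ _ _ sg cg T2 _ _ _ _ a0 ab b1 f bf aE bE fuv ec.
    by apply: (meet N _ HN); rewrite aE.
  have {}bv : 0 < b \/ f u != f v.
    have [bE|bn0] := eqVneq b 0; last by left; rewrite lt0r bn0.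
    by right; apply/negP => fuv; apply: bv.
  have [N HN] := W_seq_bipartite _ _ _ sg cg T2 _ _ _ _ a0 ab b1 f bf aE bv.
  have [M HM] := ec; pose k := maxn N M.
  have Nk : (N <= k)%N by exact: leq_maxl.
  have Mk : (M <= k)%N by exact: leq_maxr.
  (* Equality of the closed form at [k] and [k.+1] leaves the factor [(1 - 2 * b) ^+ k * b], whose
     vanishing means [b = 1 / 2] or [b = 0]. *)
  have := HM _ (leqW Mk); rewrite -(HM _ Mk) !HN ?leqW // exprS => h.
  have : sgn R T f u * sgn R T f v * ((1 - 2 * b) ^+ k * b) = 0.
    by move: h; set s := sgn _ _ _ _ * _; set q := _ ^+ k; lra.
  move/eqP; rewrite !mulf_eq0 !signr_eq0 /= expf_eq0 => /orP [/andP [_ /eqP q0]|/eqP bE].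
    by right; left; split=> //; [lra | exists f].
  left; split=> //; first by exists f.
  by rewrite (gdist_parity _ _ cg f) //; case: bv => //; rewrite bE ltxx.
case=> [[aE bE [f bf] od]|[[aE bE [f bf]]|[[aE bE nE]|[[aE bE euv nE]|[abE uv]]]]].
- rewrite (gdist_parity _ _ cg f) // in od.
  have [N HN] := W_seq_bipartite _ _ _ sg cg T2 _ _ _ _ a0 ab b1 f bf aE (or_intror od).
  by exists N => k Nk; rewrite !HN // bE mulr0 subr0 !expr1n.
- have bv : 0 < b \/ f u != f v by left; rewrite bE divr_gt0.
  have [N HN] := W_seq_bipartite _ _ _ sg cg T2 _ _ _ _ a0 ab b1 f bf aE bv.
  have q0 : 1 - 2 * b = 0 by rewrite bE; field.
  (* Starting at [N.+1] keeps the exponent positive, since [0 ^+ 0 = 1]. *)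
  exists N.+1 => k Nk; rewrite (HN _ (ltnW Nk)) (HN _ (leqnSn N)) q0 !expr0n.
  by case: k Nk.
- rewrite aE bE; apply: meet_eventually_constant => //.
  exact: kernel_eq_nbhd.
- rewrite bE -aE; apply: meet_eventually_constant => //.
  exact: kernel_eq_twins.
- by rewrite -abE uv; apply: meet_eventually_constant.
Qed.
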